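(* Let $\mathcal{A}$ be a symmetric Banach algebra, let $(X_\sigma)_{\sigma\in\Lambda}$ be an approximation scheme on $\mathcal{A}$, and let $1\le p\le\infty$, $r>0$. Then the approximation space $\mathcal{E}^p_r(\mathcal{A})$ is inverse-closed in $\mathcal{A}$.
   Context: All Banach algebras are complex and unital with unit $\mathbf{1}$. A symmetric Banach algebra is a Banach $*$-algebra in which the spectrum of $a^*a$ is contained in $[0,\infty)$ for every $a$. For algebras $\mathcal{A}\subseteq\mathcal{B}$ with common unit, $\mathcal{A}$ is inverse-closed in $\mathcal{B}$ if $a\in\mathcal{A}$, $a^{-1}\in\mathcal{B}$ imply $a^{-1}\in\mathcal{A}$. Let $\Lambda$ be $\mathbb{R}^+_0=[0,\infty)$ or $\mathbb{N}_0$. An approximation scheme on a Banach $*$-algebra $\mathcal{A}$ is a family $(X_\sigma)_{\sigma\in\Lambda}$ of closed linear subspaces of $\mathcal{A}$ such that $X_0=\{0\}$; $X_\sigma\subseteq X_\tau$ for $\sigma\le\tau$; $X_\sigma\cdot X_\tau\subseteq X_{\sigma+\tau}$ for all $\sigma,\tau\in\Lambda$; $\mathbf{1}\in X_1$; and $X_\sigma=X_\sigma^*$ for all $\sigma$. The approximation error is $E_\sigma(a)=\inf_{x\in X_\sigma}\|a-x\|_{\mathcal{A}}$. The space $\mathcal{E}^p_r(\mathcal{A})$ consists of all $a\in\mathcal{A}$ with finite norm, where for $1\le p<\infty$ $$\|a\|_{\mathcal{E}^p_r}^p=\int_0^\infty E_\sigma(a)^p(\sigma+1)^{rp}\frac{d\sigma}{\sigma+1}\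 \text{ if }\Lambda=\mathbb{R}^+_0,\qquad \|a\|_{\mathcal{E}^p_r}^p=\sum_{k=0}^\infty E_k(a)^p(k+1)^{rp}\frac1{k+1}\ \text{ if }\Lambda=\mathbb{N}_0,$$ and for $p=\infty$, $\|a\|_{\mathcal{E}^\infty_r}=\sup_{\sigma\in\Lambda}E_\sigma(a)(\sigma+1)^r$. *)

(* Defs.v *)
From HB Require Import structures.
From mathcomp Require Import all_boot all_order all_algebra.
From mathcomp Require Import complex.
From mathcomp Require Import all_classical all_reals all_analysis.

Set Implicit Arguments.
Unset Strict Implicit.
Unset Printing Implicit Defensive.

Import Order.TTheory GRing.Theory Num.Theory.
Import numFieldNormedType.Exports.

Local Open Scope classical_set_scope.
Local Open Scope ring_scope.

(* The ring operations are fields of the mixin because HB rejects a structure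
   that inherits both from normedModType and from nzRingType (numDomainType
   already joins a norm and a ring); the unitAlgType structure is provided by
   the instances below.  The norm of 1 is not required to be 1. *)
HB.mixin Record isBanachAlgebra (K : numFieldType) A
    of CompleteNormedModule K A := {
  banach_one : A;
  banach_mul : A -> A -> A;
  banach_mulA : associative banach_mul;
  banach_mul1r : left_id banach_one banach_mul;
  banach_mulr1 : right_id banach_one banach_mul;
  banach_mulDl : left_distributive banach_mul +%R;
  banach_mulDr : right_distributive banach_mul +%R;
  banach_scaleAl : forall (c : K) (x y : A),
    c *: banach_mul x y = banach_mul (c *: x) y;
  banach_scaleAr : forall (c : K) (x y : A),
    c *: banach_mul x y = banach_mul x (c *: y);
  banach_one_neq0 : banach_one != 0;
  banach_normM : forall x y : A, `|banach_mul x y| <= `|x| * `|y|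
}.

#[short(type="banachAlgType")]
HB.structure Definition BanachAlgebra (K : numFieldType) :=
  {A of CompleteNormedModule K A & isBanachAlgebra K A}.

Section BanachAlgebraUnitAlgebra.
Variables (K : numFieldType) (A : banachAlgType K).

HB.instance Definition _ := GRing.Zmodule_isNzRing.Build (BanachAlgebra.sort A)
  (@banach_mulA K A) (@banach_mul1r K A) (@banach_mulr1 K A)
  (@banach_mulDl K A) (@banach_mulDr K A) (@banach_one_neq0 K A).

HB.instance Definition _ :=
  GRing.Lmodule_isLalgebra.Build K (BanachAlgebra.sort A) (@banach_scaleAl K A).

HB.instance Definition _ :=
  GRing.Lalgebra_isAlgebra.Build K (BanachAlgebra.sort A) (@banach_scaleAr K A).

Definition banach_unit : pred A :=
  fun x => `[< exists y : A, y * x = 1 /\ x * y = 1 >].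

Definition banach_inv (x : A) : A :=
  match pselect (exists y : A, y * x = 1 /\ x * y = 1) with
  | left e => projT1 (cid e)
  | right _ => x
  end.

Fact banach_mulVr : {in banach_unit, left_inverse 1 banach_inv *%R}.
Proof.
move=> x /asboolP ex; rewrite /banach_inv; case: pselect => [e|//].
by case: (projT2 (cid e)).
Qed.

Fact banach_divrr : {in banach_unit, right_inverse 1 banach_inv *%R}.
Proof.
move=> x /asboolP ex; rewrite /banach_inv; case: pselect => [e|//].
by case: (projT2 (cid e)).
Qed.

Fact banach_unitrP (x y : A) : y * x = 1 /\ x * y = 1 -> banach_unit x.
Proof. by move=> xy; apply/asboolP; exists y. Qed.

Fact banach_invr_out : {in [predC banach_unit], banach_inv =1 id}.
Proof.
move=> x; rewrite inE /= => /asboolP nex.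
by rewrite /banach_inv; case: pselect.
Qed.

HB.instance Definition _ :=
  GRing.NzRing_hasMulInverse.Build (BanachAlgebra.sort A)
    banach_mulVr banach_divrr banach_unitrP banach_invr_out.

End BanachAlgebraUnitAlgebra.

(* No relation between the involution and the norm is imposed: isometric, or
   merely continuous, involutions are particular cases. *)
Record is_involution (R : realType) (A : banachAlgType R[i])
    (star : A -> A) : Prop := {
  starK : involutive star;
  starD : forall x y, star (x + y) = star x + star y;
  starZ : forall (c : R[i]) x, star (c *: x) = conjc c *: star x;
  starM : forall x y, star (x * y) = star y * star x
}.

Definition spectrum (K : numFieldType) (A : banachAlgType K) (a : A) : set K :=
  [set z | a - z%:A \isn't a GRing.unit].

(* The order of R[i] is partial: 0 <= z means that z is real and nonnegative. *)
Definition symmetric_algebra (R : realType) (A : banachAlgType R[i])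
    (star : A -> A) : Prop :=
  is_involution star /\
  forall a : A, spectrum (star a * a) `<=` [set z | 0 <= z].

(* The first conjunct says that S is a subalgebra containing the unit. *)
Definition inverse_closed (K : numFieldType) (B : banachAlgType K)
    (S : set B) : Prop :=
  GRing.subalg_closed (mem S) /\
  (forall a, S a -> a \is a GRing.unit -> S a^-1).

Inductive index_kind := nonneg_reals | naturals.

(* Both index sets are viewed inside R; the values of a scheme outside of
   [index_set k] are irrelevant. *)
Definition index_set (R : realType) (k : index_kind) : set R :=
  match k with
  | nonneg_reals => [set s | 0 <= s]
  | naturals => range (fun n : nat => n%:R)
  end.

Record approximation_scheme (R : realType) (A : banachAlgType R[i])
    (star : A -> A) (k : index_kind) (X : R -> set A) : Prop := {
  scheme_submod : forall s, index_set k s -> GRing.submod_closed (mem (X s));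
  scheme_closed : forall s, index_set k s -> closed (X s);
  scheme0 : X 0 = [set 0];
  scheme_mono : forall s t, index_set k s -> index_set k t ->
    s <= t -> X s `<=` X t;
  scheme_mul : forall s t, index_set k s -> index_set k t ->
    forall x y, X s x -> X t y -> X (s + t) (x * y);
  scheme1 : X 1 1;
  scheme_star : forall s, index_set k s -> X s = star @` X s
}.

(* The norm of A takes its values in R[i]; they are real and nonnegative, and
   [complex.Re] reads them in R. *)
Definition approx_error (R : realType) (A : banachAlgType R[i])
    (X : R -> set A) (s : R) (a : A) : R :=
  inf [set complex.Re `|a - x| | x in X s].

(* The case p = -oo is a dummy value: only p >= 1 is meaningful. *)
Definition approx_norm (R : realType) (A : banachAlgType R[i])
    (k : index_kind) (X : R -> set A) (p : \bar R) (r : R) (a : A) : \bar R :=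
  match p with
  | q%:E =>
      let f (s : R) : R :=
        approx_error X s a `^ q * (s + 1) `^ (r * q) / (s + 1) in
      poweR
        (match k with
         | nonneg_reals => \int[lebesgue_measure]_(s in `[0%R, +oo[) (f s)%:E
         | naturals => \sum_(0 <= n <oo) (f n%:R)%:E
         end)%E q^-1
  | +oo%E => ereal_sup
      [set (approx_error X s a * (s + 1) `^ r)%:E | s in index_set k]
  | -oo%E => 0%E
  end.

Definition approx_space (R : realType) (A : banachAlgType R[i])
    (k : index_kind) (X : R -> set A) (p : \bar R) (r : R) : set A :=
  [set a | (approx_norm k X p r a < +oo)%E].

(* Main.v *)
Require Import Defs.
From HB Require Import structures.
From mathcomp Require Import all_boot all_order all_algebra.
From mathcomp Require Import complex.
From mathcomp Require Import all_classical all_reals all_analysis.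
From mathcomp Require Import measurable_realfun ring lra.

Import Order.TTheory GRing.Theory Num.Theory.
Import numFieldNormedType.Exports.
Local Open Scope classical_set_scope.
Local Open Scope ring_scope.

(* Write E_s for the approximation error. Since s |-> E_s(a) is nonincreasing,
   a belongs to the approximation space exactly when the dyadic sequence
   2^(jr) E_(2^j)(a) is in l^p, for both index sets. If u = (1 - d)^-1 with d in
   the space, then u = 1 + d u yields
     E_(2^(j+1))(u) <= |d| E_(2^j)(u) + 2 |u| E_(2^j)(d),
   so u is in the space as soon as |d| <= 2^-r / 4 for the norm of A alone.
   Hence, among the invertible elements of the space, those whose inverse stays
   in the space form a relatively open and closed set for the norm of A.
   If x in X_(2^j) is invertible, the segment from 1 to x^* x consists of
   invertible elements by symmetry, so (x^* x)^-1, and then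
   x^-1 = (x^* x)^-1 x^*, is in the space. A general invertible a is a limit of
   such x. The involution is only applied to elements of the scheme, so that it
   need not be continuous. *)

(** * Boundedness in l^p of nonnegative sequences *)

Section LpSequences.
Variable R : realType.
Set Implicit Arguments.
Unset Strict Implicit.
Implicit Types (s t u : nat -> R) (p : \bar R) (q c d : R).

Lemma powR_add_le q x y : 0 <= q -> 0 <= x -> 0 <= y ->
  (x + y) `^ q <= 2 `^ q * (x `^ q + y `^ q) :> R.
Proof.
move=> q0.
wlog xy : x y / x <= y => [H x0 y0|x0 y0].
  have [xy|/ltW yx] := leP x y; first exact: H.
  by rewrite addrC (addrC (x `^ q)) H.
apply: (@le_trans _ _ ((2 * y) `^ q)).
  by apply: ge0_ler_powR => //; rewrite ?nnegrE ?addr_ge0 ?mulr_ge0//; lra.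
by rewrite powRM// ler_wpM2l ?powR_ge0// lerDr powR_ge0.
Qed.

(** Membership in l^p through uniform bounds on partial sums, meant for nonnegative sequences. The
    last branch serves p = +oo, where an upper bound is then enough. *)
Definition lp_bounded p t : Prop :=
  match p with
  | q%:E => exists M, forall n, \sum_(j < n) t j `^ q <= M
  | _ => exists M, forall n, t n <= M
  end.

Lemma lp_bounded_lincomb p c d s t u : (1%:E <= p)%E -> 0 <= c -> 0 <= d ->
  (forall j, 0 <= s j) -> (forall j, 0 <= t j) -> (forall j, 0 <= u j) ->
  (forall j, u j <= c * s j + d * t j) ->
  lp_bounded p s -> lp_bounded p t -> lp_bounded p u.
Proof.
case: p => [q|_|//] /= => [|c0 d0 s0 t0 u0 ule [M sM] [N tN]]; last first.
  exists (c * M + d * N) => n; apply: (le_trans (ule n)).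
  by rewrite lerD// ler_wpM2l.
rewrite lee_fin => q1 c0 d0 s0 t0 u0 ule [M sM] [N tN].
have q0 : 0 <= q by rewrite (le_trans _ q1).
exists (2 `^ q * (c `^ q * M + d `^ q * N)) => n.
apply: (@le_trans _ _
  (\sum_(j < n) 2 `^ q * (c `^ q * s j `^ q + d `^ q * t j `^ q))).
  apply: ler_sum => j _.
  apply: (@le_trans _ _ ((c * s j + d * t j) `^ q)).
    apply: ge0_ler_powR => //; rewrite ?nnegrE//.
    by rewrite addr_ge0// mulr_ge0.
  by rewrite -!powRM// powR_add_le// mulr_ge0.
rewrite -mulr_sumr big_split/= -!mulr_sumr ler_wpM2l ?powR_ge0//.
by rewrite lerD// ler_wpM2l ?powR_ge0.
Qed.

(** Raising the recurrence to the power q costs a factor 2^q, and 2^q 4^-q <= 1/2 since q >= 1, so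
    at most half of the previous partial sum reappears. *)
Lemma lp_bounded_recurrence p s t : (1%:E <= p)%E ->
  (forall j, 0 <= s j) -> (forall j, 0 <= t j) ->
  (forall j, s j.+1 <= 4^-1 * s j + t j) -> lp_bounded p t -> lp_bounded p s.
Proof.
case: p => [q|_|//] /= => [|s0 t0 srec [M tM]]; last first.
  exists (s 0%N + 2 * M); elim=> [|n IH].
    by have := le_trans (t0 0%N) (tM 0%N); lra.
  by have := srec n; have := tM n; have := t0 n; have := s0 0%N; lra.
rewrite lee_fin => q1 s0 t0 srec [M tM].
have q0 : 0 <= q by rewrite (le_trans _ q1).
have half : 2 `^ q * 4^-1 `^ q <= 2^-1 :> R.
  rewrite -powRM// (_ : 2 * 4^-1 = 2^-1); last by field.
  by rewrite ge1r_powR//; apply/andP; split; lra.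
have C0 : 0 <= s 0%N `^ q + 2 `^ q * M.
  rewrite addr_ge0 ?powR_ge0// mulr_ge0 ?powR_ge0//.
  by have := tM 0%N; rewrite big_ord0.
(* This bound is the fixed point B = s_0^q + B / 2 + 2^q M of the induction step. *)
exists (2 * (s 0%N `^ q + 2 `^ q * M)); elim=> [|n IH].
  by rewrite big_ord0 mulr_ge0.
rewrite big_ord_recl/=.
have : \sum_(i < n) s (lift ord0 i) `^ q <=
    \sum_(i < n) (2^-1 * s i `^ q + 2 `^ q * t i `^ q).
  apply: ler_sum => i _; rewrite lift0.
  apply: (@le_trans _ _ ((4^-1 * s i + t i) `^ q)).
    by apply: ge0_ler_powR; rewrite ?nnegrE ?addr_ge0 ?mulr_ge0.
  apply: (le_trans (powR_add_le q0 _ (t0 i))); first exact: mulr_ge0.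
  rewrite mulrDr lerD2r.
  by rewrite powRM// mulrA ler_wpM2r ?powR_ge0.
rewrite big_split/= -!mulr_sumr => h.
have := ler_wpM2l (powR_ge0 2 q) (tM n).
lra.
Qed.

Lemma lp_bounded_finite_support p s J : (1%:E <= p)%E -> (forall j, 0 <= s j) ->
  (forall j, (J <= j)%N -> s j = 0) -> lp_bounded p s.
Proof.
move=> p1; elim: J s => [|J IH] s s0 sJ.
  have -> : s = fun=> 0 by apply/funext => j; exact: sJ.
  case: p p1 => [q|_|//] /= => [q1|]; last by exists 0.
  exists 0 => n; rewrite big1// => j _; rewrite powR0//.
  by rewrite gt_eqF// (lt_le_trans ltr01).
(* The recurrence holds trivially with the shifted sequence as perturbation, and the shift shortens
   the support by one. *)
apply: (@lp_bounded_recurrence _ _ (fun j => s j.+1)) => // [j|].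
  by rewrite lerDr mulr_ge0.
by apply: IH => // j Jj; exact: sJ.
Qed.

Lemma lp_bounded_sup p s : (1%:E <= p)%E -> (forall j, 0 <= s j) ->
  lp_bounded p s -> exists M, forall j, s j <= M.
Proof.
case: p => [q|//|//] /=; rewrite lee_fin => q1 s0 [M sM].
have q0 : 0 <= q by rewrite (le_trans _ q1).
(* A term above 1 is at most its q-th power, hence at most M; the empty partial sum gives
   [0 <= M]. *)
exists (1 + M) => j; have [s1|s1] := leP (s j) 1.
  have := sM 0%N; rewrite big_ord0; lra.
have := sM j.+1; rewrite big_ord_recr/= => h.
have : s j `^ 1 <= s j `^ q by apply: ler_powR => //; exact: ltW.
have : 0 <= \sum_(i < j) s i `^ q by apply: sumr_ge0 => i _; exact: powR_ge0.
rewrite powRr1//; lra.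
Qed.

End LpSequences.

(** * Real-valued norm and the Neumann series *)

Section ComplexNorm.
Variables (R : realType) (A : banachAlgType R[i]).
Set Implicit Arguments.
Unset Strict Implicit.
Implicit Types x y : A.

(** Reading the norm in R gives a total order and real linear arithmetic. *)
Definition nrm x : R := complex.Re `|x|.

Lemma nrmE x : `|x| = ((nrm x)%:C)%C.
Proof. by rewrite /nrm RRe_real// ger0_real. Qed.

Lemma nrm_ge0 x : 0 <= nrm x.
Proof. by rewrite -lecR -nrmE; exact: normr_ge0. Qed.

Lemma nrm_leD x y : nrm (x + y) <= nrm x + nrm y.
Proof. by rewrite -lecR rmorphD/= -!nrmE ler_normD. Qed.

Lemma nrm_leM x y : nrm (x * y) <= nrm x * nrm y.
Proof. by rewrite -lecR rmorphM/= -!nrmE; exact: (@banach_normM _ A x y). Qed.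

Lemma nrmN x : nrm (- x) = nrm x.
Proof. by rewrite /nrm normrN. Qed.

Lemma nrmB x y : nrm (x - y) = nrm (y - x).
Proof. by rewrite /nrm distrC. Qed.

Lemma nrm0 : nrm 0 = 0.
Proof. by rewrite /nrm normr0. Qed.

Lemma nrmZ (c : R[i]) x : nrm (c *: x) = complex.Re `|c| * nrm x.
Proof.
apply: complexI; rewrite -nrmE normrZ rmorphM/= -nrmE; congr (_ * _).
Qed.

Lemma nrm_small_eq0 x : (forall e, 0 < e -> nrm x <= e) -> x = 0.
Proof.
move=> h; apply: normr0_eq0; rewrite nrmE.
suff -> : nrm x = 0 by [].
apply/eqP; rewrite eq_le nrm_ge0 andbT.
by apply/ler_addgt0Pl => e /h; rewrite addr0.
Qed.

Lemma nrmX_half x n : nrm x <= 2^-1 -> nrm (x ^+ n) <= nrm (1 : A) / 2 ^+ n.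
Proof.
move=> xh; elim: n => [|n IH]; first by rewrite !expr0 divr1.
rewrite exprS (le_trans (nrm_leM _ _))//.
have -> : nrm (1 : A) / 2 ^+ n.+1 = 2^-1 * (nrm (1 : A) / 2 ^+ n).
  by rewrite exprS invfM mulrCA.
by apply: ler_pM => //; exact: nrm_ge0.
Qed.

Lemma geometric_half_cvg x : nrm x <= 2^-1 -> cvgn (series (fun n => x ^+ n)).
Proof.
move=> xh; apply/cauchy_cvgP/cauchy_seriesP => e e0.
have [r er r0] : exists2 r : R, e = (r%:C)%C & 0 < r.
  have er : e = ((complex.Re e)%:C)%C by rewrite RRe_real// gtr0_real.
  by exists (complex.Re e) => //; rewrite -ltcR -er.
pose C := nrm (1 : A).
(* The tail is bounded by a telescoping difference, so that the induction on its length closes. *)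
have bound m l : nrm (\sum_(m <= k < m + l) x ^+ k)
    <= 2 * C / 2 ^+ m - 2 * C / 2 ^+ (m + l).
  elim: l => [|l IH]; first by rewrite addn0 big_geq// nrm0 subrr.
  rewrite addnS big_nat_recr/=; last by rewrite leq_addr.
  rewrite (le_trans (nrm_leD _ _))//.
  have := nrmX_half (m + l) xh; rewrite -/C exprS => h.
  have -> : 2 * C / (2 * 2 ^+ (m + l)) = C / 2 ^+ (m + l).
    by rewrite invfM mulrACA divff// mul1r.
  lra.
have C0 : 0 <= C by exact: nrm_ge0.
have cvg0 : (fun n => 2 * C * (2^-1) ^+ n) @ \oo --> (0 : R).
  by apply: cvg_geometric; rewrite ger0_norm//; lra.
have /cvgrPdist_lt/(_ r r0)[N _ hN] := cvg0.
exists ([set n | N <= n]%N, [set n | N <= n]%N); first by split; exists N.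
move=> [m n] [/= Nm Nn]; rewrite nrmE er ltcR.
have [mn|nm] := leqP m n; last by rewrite big_geq ?nrm0// ltnW.
rewrite -(subnKC mn); apply: (le_lt_trans (bound _ _)).
have := hN m Nm; rewrite /= sub0r normrN ger0_norm ?mulr_ge0// exprVn.
by apply: le_lt_trans; rewrite gerBl mulr_ge0// mulr_ge0.
Qed.

(** The Neumann series in d = 1 - x converges, and its partial sums invert x on both sides up to
    d^n. *)
Lemma unit_near_one x : nrm (1 - x) <= 2^-1 -> x \is a GRing.unit.
Proof.
move=> xh; pose d := 1 - x; have xE : x = 1 - d by rewrite /d opprB addrC subrK.
have /cvgrPdist_lt sl := geometric_half_cvg xh.
set l := limn _ in sl.
have C0 : 0 <= nrm (1 : A) by exact: nrm_ge0.
have small e : 0 < e -> exists n, nrm (l - \sum_(0 <= k < n) d ^+ k) <= e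
    /\ nrm (d ^+ n) <= e.
  move=> e0.
  have ec0 : 0 < ((e%:C)%C : R[i]) by rewrite ltcR.
  have [N _ hN] := sl _ ec0.
  have cvg0 : (fun n => nrm (1 : A) * (2^-1) ^+ n) @ \oo --> (0 : R).
    by apply: cvg_geometric; rewrite ger0_norm//; lra.
  have /cvgrPdist_lt/(_ e e0)[M _ hM] := cvg0.
  exists (maxn N M); split.
    by have := hN (maxn N M) (leq_maxl _ _); rewrite /= nrmE ltcR => /ltW.
  apply: (le_trans (nrmX_half _ xh)).
  have := hM (maxn N M) (leq_maxr _ _).
  by rewrite /= sub0r normrN ger0_norm ?mulr_ge0// exprVn => /ltW.
have geo n : x * \sum_(0 <= k < n) d ^+ k = 1 - d ^+ n
    /\ (\sum_(0 <= k < n) d ^+ k) * x = 1 - d ^+ n.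
  elim: n => [|n [IH1 IH2]].
    by rewrite big_geq// mulr0 mul0r expr0 subrr.
  rewrite big_nat_recr//= mulrDl mulrDr IH1 IH2.
  have -> : x * d ^+ n = d ^+ n - d ^+ n.+1 by rewrite {1}xE mulrBl mul1r -exprS.
  have -> : d ^+ n * x = d ^+ n - d ^+ n.+1 by rewrite {1}xE mulrBr mulr1 -exprSr.
  by rewrite addrA subrK.
have x0 : 0 <= nrm x by exact: nrm_ge0.
(* The defect of the limit as an inverse is d^n minus a product of x with a tail; e' makes the two
   bounds total e. *)
have split_eps e : 0 < e -> exists2 e', 0 < e' & e' + nrm x * e' = e.
  move=> e0; exists (e / (1 + nrm x)); first by rewrite divr_gt0//; lra.
  by field; rewrite gt_eqF//; lra.
apply/GRing.unitrP; exists l.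
split; apply/eqP; rewrite eq_sym -subr_eq0; apply/eqP;
  apply: nrm_small_eq0 => _ /split_eps[e e0 <-]; have [n [h1 h2]] := small _ e0.
  have -> : 1 - l * x = d ^+ n - (l - \sum_(0 <= k < n) d ^+ k) * x.
    by rewrite mulrBl (geo n).2 opprB addrA addrCA subrr addr0.
  rewrite (le_trans (nrm_leD _ _))// nrmN lerD// mulrC.
  exact: le_trans (nrm_leM _ _) (ler_wpM2r x0 h1).
have -> : 1 - x * l = d ^+ n - x * (l - \sum_(0 <= k < n) d ^+ k).
  by rewrite mulrBr (geo n).1 opprB addrA addrCA subrr addr0.
rewrite (le_trans (nrm_leD _ _))// nrmN lerD//.
exact: le_trans (nrm_leM _ _) (ler_wpM2l x0 h1).
Qed.

End ComplexNorm.

(** * Approximation errors of sums and products *)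

Section ApproximationError.
Variables (R : realType) (A : banachAlgType R[i]) (star : A -> A).
Variables (k : index_kind) (X : R -> set A).
Hypothesis hX : approximation_scheme star k X.
Set Implicit Arguments.
Unset Strict Implicit.
Implicit Types (a b x y : A) (s t : R).

Local Notation E := (approx_error X).

Lemma scheme_lincomb s c x y : index_set k s -> X s x -> X s y ->
  X s (c *: x + y).
Proof.
move=> ks Xx Xy; have [_ h] := scheme_submod hX ks.
have := h c x y; rewrite !in_setE; exact.
Qed.

Lemma scheme_zero s : index_set k s -> X s 0.
Proof.
by move=> ks; have [h _] := scheme_submod hX ks; move: h; rewrite in_setE.
Qed.

Lemma approx_error_le s a x : X s x -> E s a <= nrm (a - x).
Proof.
move=> Xx; apply: ge_inf; last by exists x.
by exists 0 => _ [y _ <-]; exact: nrm_ge0.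
Qed.

(** Passage to the infimum through an affine map. For c = 0 any point of [X s] gives the bound, and
    0 is one; otherwise one divides by c. *)
Lemma approx_error_glb s a c d t : index_set k s -> 0 <= c ->
  (forall x, X s x -> t <= c * nrm (a - x) + d) -> t <= c * E s a + d.
Proof.
move=> ks; rewrite le_eqVlt => /predU1P[<-|c0] h.
  by have := h _ (scheme_zero ks); rewrite !mul0r.
rewrite -lerBlDr -ler_pdivrMl//; apply: lb_le_inf.
  by exists (nrm (a - 0)), 0 => //; exact: scheme_zero.
by move=> _ [x Xx <-]; rewrite ler_pdivrMl// lerBlDr; exact: h.
Qed.

Lemma approx_error_ge0 s a : index_set k s -> 0 <= E s a.
Proof.
move=> ks; have := @approx_error_glb s a 1 0 0 ks ler01.
by rewrite mul1r addr0; apply => x _; rewrite mul1r addr0 nrm_ge0.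
Qed.

Lemma approx_error_le_nrm s a : index_set k s -> E s a <= nrm a.
Proof.
move=> ks; rewrite -[a in leRHS]subr0.
by apply: approx_error_le; exact: scheme_zero.
Qed.

Lemma approx_error_nincr s t a : index_set k s -> index_set k t -> s <= t ->
  E t a <= E s a.
Proof.
move=> ks kt st; have := @approx_error_glb s a 1 0 (E t a) ks ler01.
rewrite mul1r addr0; apply => x Xx; rewrite mul1r addr0.
by apply: approx_error_le; exact: (scheme_mono hX ks).
Qed.

Lemma approx_error_mem s x : index_set k s -> X s x -> E s x = 0.
Proof.
move=> ks Xx; apply/eqP; rewrite eq_le approx_error_ge0// andbT.
by have := approx_error_le x Xx; rewrite subrr nrm0.
Qed.

Lemma approx_error_lincomb s c a b : index_set k s ->
  E s (c *: a + b) <= complex.Re `|c| * E s a + E s b.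
Proof.
move=> ks; have c0 : 0 <= complex.Re `|c|.
  by rewrite -lecR RRe_real ?ger0_real//; exact: normr_ge0.
apply: approx_error_glb => // x Xx.
rewrite -(mul1r (E s b)) [leRHS]addrC; apply: approx_error_glb => // y Xy.
apply: (le_trans (approx_error_le _ (scheme_lincomb c ks Xx Xy))).
rewrite mul1r opprD addrACA -scalerBr addrC -nrmZ; exact: nrm_leD.
Qed.

(* [a b - y z = a (b - z) + (a - y) z] for [y], [z] close to [a], [b]. *)
Lemma approx_error_mul s t a b : index_set k s -> index_set k t ->
  E (s + t) (a * b) <= (nrm a + E s a) * E t b + nrm b * E s a.
Proof.
move=> ks kt; apply: approx_error_glb => // [|z Xz].
  by rewrite addr_ge0 ?nrm_ge0 ?approx_error_ge0.
have -> : (nrm a + E s a) * nrm (b - z) + nrm b * E s a =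
    (nrm b + nrm (b - z)) * E s a + nrm a * nrm (b - z) by ring.
apply: approx_error_glb => // [|y Xy].
  by rewrite addr_ge0 ?nrm_ge0.
apply: (le_trans (approx_error_le _ (scheme_mul hX ks kt Xy Xz))).
have -> : a * b - y * z = (a - y) * z + a * (b - z).
  by rewrite mulrBl mulrBr [RHS]addrC addrA addrNK.
apply: (le_trans (nrm_leD _ _)); rewrite lerD ?nrm_leM//.
apply: (le_trans (nrm_leM _ _)); rewrite mulrC ler_wpM2r ?nrm_ge0//.
by rewrite nrmB -[z in leLHS](addrNK b) addrC (le_trans (nrm_leD _ _)).
Qed.

End ApproximationError.

(** * Dyadic decomposition of sums and integrals *)

Section DyadicBlocks.
Variable R : realType.
Set Implicit Arguments.
Unset Strict Implicit.

Lemma dyadic_locate (s : R) : 1 <= s -> exists j, 2 ^+ j <= s < 2 ^+ j.+1.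
Proof.
move=> s1.
have ex : exists n, s < 2 ^+ n.
  exists (Num.truncn s).+1; apply: lt_le_trans (truncnS_gt s) _.
  by rewrite -natrX ler_nat ltnW// ltn_expl.
case: (ex_minnP ex) => -[|m] sm minm.
  by move: sm; rewrite expr0 ltNge s1.
exists m; rewrite sm andbT leNgt; apply/negP => /minm.
by rewrite ltnn.
Qed.

(* [T N] stands for the mass of [[0, 2^N)] and [B N] for that of
   [[2^N, 2^(N+1))]. *)
Lemma dyadic_blocks_bounded (T B : nat -> \bar R) (tau : nat -> R) (K c C : R) :
  (0 <= T 0%N <= K%:E)%E -> 0 < c -> 0 <= C -> (forall j, 0 <= tau j) ->
  (forall N, T N.+1 = T N + B N)%E ->
  (forall N, ((c * tau N.+1)%:E <= B N <= (C * tau N)%:E)%E) ->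
  (exists M : R, forall N, (T N <= M%:E)%E) <->
  (exists M, forall n, \sum_(j < n) tau j <= M).
Proof.
move=> /andP[T0 TK] c0 C0 tau0 TB Bb; split => [[M TM]|[M tauM]].
  have lower n : ((c * \sum_(j < n) tau j.+1)%:E <= T n)%E.
    elim: n => [|n IH]; first by rewrite big_ord0 mulr0.
    rewrite big_ord_recr/= mulrDr EFinD TB leeD//.
    by have /andP[] := Bb n.
  (* The lower bounds on blocks see [tau] from index 1 on, so [tau 0] is added separately. *)
  exists (tau 0%N + c^-1 * M) => n.
  apply: (@le_trans _ _ (\sum_(j < n.+1) tau j)).
    by rewrite big_ord_recr/= lerDl.
  rewrite big_ord_recl/= lerD2l ler_pdivlMl// -lee_fin.
  exact: le_trans (lower n) (TM n).
have upper n : (T n <= (K + C * \sum_(j < n) tau j)%:E)%E.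
  elim: n => [|n IH]; first by rewrite big_ord0 mulr0 addr0.
  rewrite big_ord_recr/= mulrDr addrA EFinD TB leeD//.
  by have /andP[] := Bb n.
exists (K + C * M) => n; apply: le_trans (upper n) _.
by rewrite lee_fin lerD2l ler_wpM2l.
Qed.

Lemma lty_EFin_bound (x : \bar R) : (x < +oo)%E <-> exists M : R, (x <= M%:E)%E.
Proof.
split=> [|[M xM]]; last exact: le_lt_trans xM (ltry _).
by case: x => [x _|//|_]; [exists x | exists 0; rewrite leNye].
Qed.

(** Partial sums increase and n < 2^n, so the dyadic ones dominate all others. *)
Lemma nneseries_dyadic_bound (f : nat -> R) : (forall n, 0 <= f n) ->
  (\sum_(0 <= n <oo) (f n)%:E < +oo)%E <->
  (exists M : R, forall N, ((\sum_(0 <= n < 2 ^ N) f n)%:E <= M%:E)%E).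
Proof.
move=> f0; have f0' n : (0 <= (f n)%:E)%E by rewrite lee_fin.
split=> [/lty_EFin_bound[M fM]|[M fM]].
  exists M => N; rewrite -sumEFin; apply: le_trans fM.
  exact: nneseries_lim_ge.
apply/lty_EFin_bound; exists M; apply: lime_le.
  by apply: is_cvg_nneseries => n _ _.
apply: nearW => n; rewrite sumEFin; apply: le_trans (fM n).
rewrite lee_fin [leRHS](@big_cat_nat _ _ _ n)//=; last by rewrite ltnW// ltn_expl.
by rewrite lerDl sumr_ge0.
Qed.

Local Notation mu := (@lebesgue_measure R).

(** Monotone convergence along the intervals [0, 2^N), which exhaust the half-line. *)
Lemma integral_dyadic_bound (f : R -> R) : (forall s, 0 <= s -> 0 <= f s) ->
  measurable_fun (`[0%R, +oo[%classic : set R) f ->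
  (\int[mu]_(s in `[0%R, +oo[) (f s)%:E < +oo)%E <->
  (exists M : R, forall N,
    (\int[mu]_(s in `[0%R, (2 ^+ N)%R[) (f s)%:E <= M%:E)%E).
Proof.
move=> f0 mf.
have sub N : (`[0%R, (2 ^+ N)%R[%classic : set R) `<=` `[0%R, +oo[.
  by move=> s /=; rewrite !in_itv/= => /andP[->].
have mfE : measurable_fun (`[0%R, +oo[%classic : set R) (EFin \o f).
  exact/measurable_EFinP.
have f0E (s : R) : [set` `[0%R, +oo[] s -> (0 <= (f s)%:E)%E.
  by rewrite /= in_itv/= andbT lee_fin; exact: f0.
have cup : `[0%R, +oo[%classic = \bigcup_N `[0%R, (2 ^+ N)%R[%classic :> set R.
  apply/seteqP; split => [s|s [N _]]; last exact: sub.
  rewrite /= in_itv/= andbT => s0; exists (Num.truncn s).+1 => //=.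
  rewrite in_itv/= s0/= (lt_le_trans (truncnS_gt s))//.
  by rewrite -natrX ler_nat ltnW// ltn_expl.
split=> [/lty_EFin_bound[M fM]|[M fM]].
  exists M => N; apply: le_trans fM; apply: ge0_subset_integral => //=.
rewrite cup; apply/lty_EFin_bound; exists M.
have h : (\int[mu]_(s in `[0%R, (2 ^+ N)%R[) (f s)%:E)%E @[N --> \oo] -->
    (\int[mu]_(s in \bigcup_N [set` `[0%R, (2 ^+ N)%R[]) (f s)%:E)%E.
  apply: (@ge0_nondecreasing_set_cvg_integral _ (measurableTypeR R) R _
    (EFin \o f) mu).
  - move=> m n mn; rewrite subsetEset => s /=; rewrite !in_itv/= => /andP[-> sm]/=.
    by rewrite (lt_le_trans sm)// ler_weXn2l// ler1n.
  - by [].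
  - by move=> N; apply: measurable_funS mfE => //; exact: sub.
  - by move=> N s /sub /f0E.
rewrite -(cvg_lim _ h)//; apply: lime_le; last by apply: nearW.
by apply/cvg_ex; eexists; exact: h.
Qed.

End DyadicBlocks.

(** * Dyadic criterion for a nonincreasing error function g *)

Section DyadicCharacterization.
Variables (R : realType) (k : index_kind) (g : R -> R) (r : R).
Hypotheses (r0 : 0 < r) (g_ge0 : forall s, index_set k s -> 0 <= g s).
Hypothesis g_nincr : forall s t, index_set k s -> index_set k t ->
  s <= t -> g t <= g s.
Set Implicit Arguments.
Unset Strict Implicit.
Implicit Types (s t q : R) (j : nat).

Lemma index_set_ge0 s : index_set k s -> 0 <= s.
Proof. by case: k => [//|[n _ <-]]. Qed.

Lemma index_set0 : index_set k (0 : R).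
Proof. by case: k => /=; [rewrite lexx | exists 0%N]. Qed.

Lemma index_set_exp2 j : index_set k (2 ^+ j : R).
Proof.
by case: k => /=; [rewrite exprn_ge0 | exists (2 ^ j)%N; rewrite // natrX].
Qed.

Let rho : R := 2 `^ r.
Let h s := g s * (s + 1) `^ r.
Let t_ j : R := rho ^+ j * g (2 ^+ j).

Let rho_gt0 : 0 < rho. Proof. exact: powR_gt0. Qed.

Let exp2_powR j : (2 ^+ j) `^ r = rho ^+ j.
Proof. by rewrite -powR_mulrn// powRAC powR_mulrn// powR_ge0. Qed.

Let t_ge0 j : 0 <= t_ j.
Proof.
rewrite mulr_ge0 ?exprn_ge0 ?(ltW rho_gt0)//.
exact/g_ge0/index_set_exp2.
Qed.

Let h_ge0 s : index_set k s -> 0 <= h s.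
Proof. by move=> ks; rewrite mulr_ge0 ?g_ge0 ?powR_ge0. Qed.

Lemma dyadic_succ_le s j : 2 ^+ j <= s < 2 ^+ j.+1 -> s + 1 <= 2 ^+ j.+2.
Proof.
move=> /andP[_]; have : 1 <= (2 : R) ^+ j by rewrite exprn_ege1// ler1n.
by rewrite !exprS; lra.
Qed.

(** Monotonicity bounds g(s) by its values at the ends of the block, and 2^j <= s + 1 <= 2^(j+2)
    bounds the weight; matching powers of [rho] leaves the two factors. *)
Let h_block s j : index_set k s -> 2 ^+ j <= s < 2 ^+ j.+1 ->
  rho^-1 * t_ j.+1 <= h s <= rho ^+ 2 * t_ j.
Proof.
move=> ks sj; have s4 := dyadic_succ_le sj; move: sj => /andP[js sj].
have s0 := index_set_ge0 ks.
rewrite /t_ /h; apply/andP; split.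
  rewrite exprS mulrA mulKf ?gt_eqF ?rho_gt0// mulrC ler_pM//.
  - exact/g_ge0/index_set_exp2.
  - by rewrite exprn_ge0// (ltW rho_gt0).
  - by apply: g_nincr; [|exact: index_set_exp2|exact: ltW].
  - rewrite -exp2_powR; apply: ge0_ler_powR;
      rewrite ?nnegrE ?exprn_ge0 ?addr_ge0 ?(ltW r0)//.
    by rewrite (le_trans js)// lerDl.
rewrite mulrA -exprD mulrC ler_pM ?powR_ge0 ?g_ge0//.
- rewrite add2n -exp2_powR; apply: ge0_ler_powR;
    by rewrite ?nnegrE ?exprn_ge0 ?addr_ge0 ?(ltW r0).
- by apply: g_nincr => //; exact: index_set_exp2.
Qed.

(** This handles [0, 1), which the dyadic blocks do not meet. *)
Let h_init s : index_set k s -> s < 1 -> h s <= rho * g 0.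
Proof.
move=> ks s1; have s0 := index_set_ge0 ks.
rewrite mulrC ler_pM ?powR_ge0 ?g_ge0//.
  by apply: g_nincr => //; exact: index_set0.
by apply: ge0_ler_powR; rewrite ?nnegrE ?addr_ge0 ?(ltW r0)//; lra.
Qed.

Lemma sup_dyadic :
  (ereal_sup [set (g s * (s + 1) `^ r)%:E | s in index_set k] < +oo)%E <->
  lp_bounded +oo t_.
Proof.
split=> [/lty_EFin_bound[M hM]|[M tM]].
  exists M => j; apply: (@le_trans _ _ (h (2 ^+ j))).
    rewrite /t_ mulrC -exp2_powR; apply: ler_wpM2l.
      exact/g_ge0/index_set_exp2.
    by apply: ge0_ler_powR; rewrite ?nnegrE ?addr_ge0 ?exprn_ge0 ?(ltW r0) ?lerDl.
  rewrite -lee_fin; apply: le_trans hM; apply: ereal_sup_ubound.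
  by exists (2 ^+ j) => //; exact: index_set_exp2.
apply/lty_EFin_bound; exists (Num.max (rho * g 0) (rho ^+ 2 * M)).
apply: ge_ereal_sup => _ [s ks <-]; rewrite lee_fin le_max.
have [s1|s1] := ltP s 1; first by rewrite h_init.
have [j /(h_block ks)/andP[_ hs]] := dyadic_locate s1.
apply/orP; right; apply: (le_trans hs); apply: ler_wpM2l => //.
by rewrite exprn_ge0// (ltW rho_gt0).
Qed.

Variable q : R.
Hypothesis q1 : 1 <= q.

Let F s := g s `^ q * (s + 1) `^ (r * q) / (s + 1).

Let q0 : 0 <= q. Proof. exact: le_trans ler01 q1. Qed.

Let FE s : index_set k s -> F s = h s `^ q / (s + 1).
Proof. by move=> ks; rewrite /F /h powRM ?powR_ge0 ?g_ge0// powRrM. Qed.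

Let F_ge0 s : index_set k s -> 0 <= F s.
Proof.
move=> ks; rewrite FE// divr_ge0 ?powR_ge0//.
by rewrite addr_ge0// index_set_ge0.
Qed.

(** On a block 1/4 <= 2^j / (s + 1) <= 1, which explains the 4^-1; the remaining factors are those
    of [h_block] raised to the power q. *)
Let c := 4^-1 * rho^-1 `^ q.
Let C := (rho ^+ 2) `^ q.

(** The factor 2^j is both the length of the block and its number of integers, so this pointwise
    estimate yields the mass of the block in either case. *)
Let F_block s j : index_set k s -> 2 ^+ j <= s < 2 ^+ j.+1 ->
  c * t_ j.+1 `^ q <= 2 ^+ j * F s <= C * t_ j `^ q.
Proof.
move=> ks sj; have /andP[lo up] := h_block ks sj; have s4 := dyadic_succ_le sj.
move: sj => /andP[js sj].
have rp := ltW rho_gt0.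
have s1 : 0 < s + 1 by rewrite ltr_wpDl// index_set_ge0.
have h0 := h_ge0 ks.
have -> : 2 ^+ j * F s = 2 ^+ j / (s + 1) * h s `^ q.
  by rewrite FE// mulrCA [LHS]mulrC.
apply/andP; split.
  rewrite /c -mulrA; apply: ler_pM.
  - by [].
  - by rewrite mulr_ge0 ?powR_ge0.
  - by rewrite ler_pdivlMr// mulrC ler_pdivrMr//; rewrite !exprS in s4; lra.
  - rewrite -powRM ?invr_ge0 ?t_ge0//; apply: ge0_ler_powR => //.
    + by rewrite nnegrE mulr_ge0 ?invr_ge0 ?t_ge0.
rewrite -powRM ?exprn_ge0 ?t_ge0// -[leRHS]mul1r; apply: ler_pM => //.
- by rewrite divr_ge0 ?exprn_ge0 ?(ltW s1).
- exact: powR_ge0.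
- by rewrite ler_pdivrMr// mul1r; lra.
- apply: ge0_ler_powR => //; rewrite ?nnegrE// mulr_ge0 ?t_ge0 ?exprn_ge0//.
Qed.

Let F_init s : index_set k s -> s < 1 -> F s <= (rho * g 0) `^ q.
Proof.
move=> ks s1; have s0 := index_set_ge0 ks; rewrite FE// ler_pdivrMr; last lra.
apply: (@le_trans _ _ ((rho * g 0) `^ q)).
  apply: ge0_ler_powR => //; rewrite ?nnegrE ?h_ge0 ?h_init//.
  by rewrite mulr_ge0 ?(ltW rho_gt0) ?g_ge0//; exact: index_set0.
by rewrite ler_peMr ?powR_ge0//; lra.
Qed.

Let c_gt0 : 0 < c.
Proof. by rewrite mulr_gt0 ?powR_gt0 ?invr_gt0 ?rho_gt0. Qed.

Let C_ge0 : 0 <= C. Proof. exact: powR_ge0. Qed.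

Lemma sum_dyadic : k = naturals ->
  (\sum_(0 <= n <oo) (F n%:R)%:E < +oo)%E <-> lp_bounded q%:E t_.
Proof.
move=> kE; have kn n : index_set k (n%:R : R) by rewrite kE; exists n.
rewrite (nneseries_dyadic_bound (fun n => F_ge0 (kn n))).
apply: (@dyadic_blocks_bounded _
    (fun N => (\sum_(0 <= n < 2 ^ N) F n%:R)%:E)
    (fun N => (\sum_(2 ^ N <= n < 2 ^ N.+1) F n%:R)%:E)
    (fun j => t_ j `^ q) (F 0) _ _ _ c_gt0 C_ge0).
- by rewrite expn0 big_nat1 !lee_fin lexx andbT; apply: F_ge0; exact: index_set0.
- by move=> j; exact: powR_ge0.
- by move=> N; rewrite -EFinD -big_cat_nat// leq_exp2l.
move=> N; rewrite !lee_fin.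
have e0 : 0 < (2 : R) ^+ N by rewrite exprn_gt0.
(* A constant is spread evenly over the 2^N integers of the block, reducing the comparison to single
   terms. *)
have sumc (a : R) : \sum_(2 ^ N <= n < 2 ^ N.+1) (a / 2 ^+ N) = a.
  rewrite sumr_const_nat expnS mul2n -addnn addnK.
  rewrite -[_ *+ (2 ^ N)%N]mulr_natr natrX.
  by rewrite mulfVK// gt_eqF.
rewrite -[c * _]sumc -[C * _]sumc.
apply/andP; split; apply: ler_sum_nat => n /andP[n1 n2];
  have nb : 2 ^+ N <= (n%:R : R) < 2 ^+ N.+1
    by rewrite -!natrX ler_nat ltr_nat n1.
  by rewrite ler_pdivrMr// [leRHS]mulrC; have /andP[] := F_block (kn n) nb.
by rewrite ler_pdivlMr// [leLHS]mulrC; have /andP[] := F_block (kn n) nb.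
Qed.

Local Notation mu := (@lebesgue_measure R).

Lemma integral_dyadic : k = nonneg_reals ->
  (\int[mu]_(s in `[0%R, +oo[) (F s)%:E < +oo)%E <-> lp_bounded q%:E t_.
Proof.
move=> kE; have ks s : 0 <= s -> index_set k s by rewrite kE.
have mF : measurable_fun (`[0%R, +oo[%classic : set R) F.
  (* Measurability comes from monotonicity. As g is known to be monotone on [0, +oo) only,
     truncating its argument at 0 extends it to a monotone function on R. *)
  have mG : measurable_fun (`[0%R, +oo[%classic : set R)
      (fun s => g (Num.max s 0) `^ q * (s + 1) `^ (r * q) * (Num.max s 0 + 1)^-1).
    have max0 s : 0 <= Num.max s 0 by rewrite le_max lexx orbT.
    have max_nd s t : s <= t -> Num.max s 0 <= Num.max t 0.
      by move=> st; rewrite ge_max !le_max st lexx !orbT.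
    apply: measurable_funM; first apply: measurable_funM.
    - apply: (measurableT_comp (measurable_powR q)).
      apply: nonincreasing_measurable => // s t st.
      by apply: g_nincr; [exact/ks|exact/ks|exact: max_nd].
    - apply: (measurableT_comp (measurable_powR (r * q))).
      by apply: nondecreasing_measurable => // s t st; rewrite lerD2r.
    - apply: nonincreasing_measurable => // s t st.
      by rewrite lef_pV2 ?posrE ?ltr_wpDl// lerD2r max_nd.
  apply: eq_measurable_fun mG => s; rewrite inE/= in_itv/= andbT => s0.
  by rewrite /F max_l.
have F0 s : 0 <= s -> 0 <= F s by move=> s0; exact/F_ge0/ks.
rewrite integral_dyadic_bound//.
have sub (a b : R) : 0 <= a -> [set` `[a, b[] `<=` (`[0%R, +oo[%classic : set R).
  move=> a0 s /=; rewrite !in_itv/= andbT => /andP[as_ _].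
  exact: le_trans as_.
have mFab (a b : R) : 0 <= a ->
    measurable_fun ([set` `[a, b[] : set R) (EFin \o F).
  move=> a0; apply/measurable_EFinP.
  by apply: measurable_funS mF => //; exact: sub.
have F0ab (a b s : R) : 0 <= a -> [set` `[a, b[] s -> (0 <= (F s)%:E)%E.
  move=> a0 /(sub _ _ a0)/=; rewrite in_itv/= andbT lee_fin; exact: F0.
have intcst (a b x : R) : a < b ->
    (\int[mu]_(s in `[a, b[) x%:E = (x * (b - a))%:E)%E.
  move=> ab; rewrite integral_cst//= lebesgue_measure_itv/= lte_fin ab.
  by rewrite -EFinB -EFinM.
apply: (@dyadic_blocks_bounded _
    (fun N => \int[mu]_(s in `[0%R, (2 ^+ N)%R[) (F s)%:E)%E
    (fun N => \int[mu]_(s in `[(2 ^+ N)%R, (2 ^+ N.+1)%R[) (F s)%:E)%E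
    (fun j => t_ j `^ q) ((rho * g 0) `^ q) _ _ _ c_gt0 C_ge0).
- rewrite expr0; apply/andP; split.
    by apply: integral_ge0 => s; exact: F0ab.
  rewrite -[leRHS]/((_ : R)%:E) -[X in (_ <= X%:E)%E]mulr1 -[X in (_ * X)%R]subr0.
  rewrite -intcst//; apply: ge0_le_integral => //=.
  + by move=> s; exact: F0ab.
  + exact: mFab.
  + move=> s; rewrite in_itv/= lee_fin => /andP[s0 s1].
    by apply: F_init => //; exact: ks.
- by move=> j; exact: powR_ge0.
- move=> N; rewrite -ge0_integral_setU//=.
  + rewrite -itv_bndbnd_setU// bnd_simp ?exprn_ge0//.
    by rewrite ler_weXn2l// ler1n.
  + rewrite -itv_bndbnd_setU// ?bnd_simp ?exprn_ge0//; first exact: mFab.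
    by rewrite ler_weXn2l// ler1n.
  + by move=> s [] ; apply: F0ab => //; rewrite exprn_ge0.
  + rewrite disj_set2E; apply/eqP/seteqP; split => // s [/=].
    by rewrite !in_itv/= => /andP[_ s1] /andP[s2 _]; move: s1; rewrite ltNge s2.
move=> N.
have e0 : 0 < (2 : R) ^+ N by rewrite exprn_gt0.
have intc (a : R) :
    (a%:E = \int[mu]_(s in `[(2 ^+ N)%R, (2 ^+ N.+1)%R[) (a / 2 ^+ N)%:E)%E.
  rewrite intcst; last by rewrite exprS; lra.
  by congr EFin; rewrite exprS; field; rewrite gt_eqF.
rewrite [(c * _)%:E]intc [(C * _)%:E]intc; apply/andP; split;
  apply: ge0_le_integral => //=.
- move=> s _; rewrite lee_fin divr_ge0 ?(ltW e0)// mulr_ge0 ?powR_ge0//.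
  exact: ltW c_gt0.
- by apply: mFab; exact: ltW.
- move=> s; rewrite in_itv/= lee_fin => sb; rewrite ler_pdivrMr// [leRHS]mulrC.
  have s0 : 0 <= s by case/andP: sb => /(le_trans (ltW e0)).
  by have /andP[] := F_block (ks _ s0) sb.
- by move=> s; apply: F0ab; exact: ltW.
- by apply: mFab; exact: ltW.
- move=> s; rewrite in_itv/= lee_fin => sb; rewrite ler_pdivlMr// [leLHS]mulrC.
  have s0 : 0 <= s by case/andP: sb => /(le_trans (ltW e0)).
  by have /andP[] := F_block (ks _ s0) sb.
Qed.

End DyadicCharacterization.

(** * Connectedness of the unit interval *)

Section UnitIntervalInduction.
Variable R : realType.

(** Let m be the supremum of the x such that P holds on [0, x]. Local constancy at m gives P m, then
    extends the segment beyond m unless the neighbourhood already contains 1. *)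
Lemma unit_interval_locally_constant (P : R -> Prop) :
  (forall x, 0 <= x <= 1 -> exists2 e, 0 < e &
     forall y, 0 <= y <= 1 -> `|x - y| < e -> P x <-> P y) ->
  P 0 -> P 1.
Proof.
move=> Ploc P0.
pose S : set R := [set x | 0 <= x <= 1 /\ forall y, 0 <= y <= x -> P y].
have S0 : S 0.
  split=> [|y]; first by rewrite lexx ler01.
  by move=> /le_anti <-.
have supS : has_sup S by split; [exists 0 | exists 1 => x [/andP[]]].
have m0 : 0 <= sup S by apply: ub_le_sup => //; exact: supS.2.
have m1 : sup S <= 1 by apply: ge_sup; [exists 0 | move=> x [/andP[]]].
have m01 : 0 <= sup S <= 1 by rewrite m0.
have [e e0 Pe] := Ploc _ m01.
have [x [x01 Px] mx] := sup_adherent e0 supS.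
have xm : x <= sup S by apply: ub_le_sup; [exact: supS.2|].
have Pm : P (sup S).
  apply/(Pe x) => //; last by apply: Px; rewrite lexx andbT; case/andP: x01.
  by rewrite ltr_norml; apply/andP; split; lra.
have Pnear y : 0 <= y <= 1 -> y < sup S + e -> P y.
  move=> y01 ym; have [yx|xy] := leP y x.
    by apply: Px; rewrite yx andbT; case/andP: y01.
  by apply/(Pe y) => //; rewrite ltr_norml; apply/andP; split; lra.
apply: (Pnear 1); first by rewrite ler01 lexx.
rewrite ltNge; apply/negP => m_small.
have : S (sup S + e / 2).
  split=> [|y /andP[y0 ym]]; first by apply/andP; split; lra.
  by apply: Pnear; [apply/andP; split|]; lra.
by move=> /(ub_le_sup supS.2); lra.
Qed.

End UnitIntervalInduction.

(** * Products and inverses in the approximation space *)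

Section ApproximationSpace.
Variables (R : realType) (A : banachAlgType R[i]) (star : A -> A).
Variables (k : index_kind) (X : R -> set A) (p : \bar R) (r : R).
Hypotheses (hX : approximation_scheme star k X).
Hypotheses (hp : (1%:E <= p)%E) (hr : 0 < r).
Set Implicit Arguments.
Unset Strict Implicit.
Implicit Types a b c d u v x y : A.

Let E := approx_error X.
Let S := approx_space k X p r.
Let rho : R := 2 `^ r.
Let t_ a j := rho ^+ j * E (2 ^+ j) a.

Lemma approx_space_dyadic a : S a <-> lp_bounded p (t_ a).
Proof.
have g0 s : index_set k s -> 0 <= approx_error X s a.
  by move=> ks; exact: (approx_error_ge0 hX).
have gn s t : index_set k s -> index_set k t -> s <= t -> E t a <= E s a.
  by move=> ks kt st; exact: (approx_error_nincr hX).
rewrite /S /approx_space/= /approx_norm; case: p hp => [q| |//] /=; last first.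
  by move=> _; exact: sup_dyadic.
rewrite lee_fin => q1; have q0 : q^-1 != 0.
  by rewrite invr_neq0// gt_eqF// (lt_le_trans ltr01).
have inner (w : \bar R) : (poweR w q^-1 < +oo)%E <-> (w < +oo)%E.
  by split; [exact: lty_poweRy | exact: poweR_lty].
rewrite inner; case kE: k.
  exact: (integral_dyadic hr g0 gn q1 kE).
exact: (sum_dyadic hr g0 gn q1 kE).
Qed.

Let idx2 j : index_set k (2 ^+ j : R) := index_set_exp2 R k j.

Let rho1 : 1 < rho.
Proof.
rewrite /rho; have := @gt0_ltr_powR R r hr 1 2.
rewrite !nnegrE powR1; apply => //; lra.
Qed.

Let rho0 : 0 < rho. Proof. exact: lt_trans ltr01 rho1. Qed.

Let E_ge0 j a : 0 <= E (2 ^+ j) a.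
Proof. exact: (approx_error_ge0 hX). Qed.

Let t_ge0 a j : 0 <= t_ a j.
Proof. by rewrite mulr_ge0// exprn_ge0// ltW. Qed.

Lemma approx_space_scheme j x : X (2 ^+ j) x -> S x.
Proof.
move=> Xx; apply/approx_space_dyadic.
apply: (@lp_bounded_finite_support _ _ _ j) => // i ji.
rewrite /t_ /E (approx_error_mem hX) ?mulr0//.
by apply: (scheme_mono hX) Xx => //; rewrite ler_weXn2l// ler1n.
Qed.

Lemma approx_space_one : S 1.
Proof.
by apply: (@approx_space_scheme 0); rewrite expr0; exact: (scheme1 hX).
Qed.

Lemma approx_space_lincomb (z : R[i]) a b : S a -> S b -> S (z *: a + b).
Proof.
move=> /approx_space_dyadic Sa /approx_space_dyadic Sb; apply/approx_space_dyadic.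
have z0 : 0 <= complex.Re `|z|.
  by rewrite -lecR RRe_real ?ger0_real//; exact: normr_ge0.
apply: (lp_bounded_lincomb hp z0 ler01 _ _ _ _ Sa Sb) => // j.
rewrite mul1r /t_ mulrCA -mulrDr ler_wpM2l//; first by rewrite exprn_ge0// ltW.
exact: (approx_error_lincomb hX).
Qed.

Lemma approx_space_sub a b : S a -> S b -> S (a - b).
Proof.
by move=> Sa Sb; rewrite addrC -scaleN1r; exact: approx_space_lincomb.
Qed.

(** Splitting 2^(j+1) as 2^j + 2^j costs one factor [rho]; the product of the two errors is absorbed
    by bounding the error of b by [nrm b], whence the 2. *)
Let t_mul a b j :
  t_ (a * b) j.+1 <= rho * nrm a * t_ b j + rho * (2 * nrm b) * t_ a j.
Proof.
have -> : rho * nrm a * t_ b j + rho * (2 * nrm b) * t_ a j =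
    rho ^+ j.+1 * (nrm a * E (2 ^+ j) b + 2 * nrm b * E (2 ^+ j) a).
  by rewrite /t_ exprS; ring.
rewrite /t_ ler_wpM2l//; first by rewrite exprn_ge0// ltW.
rewrite (_ : 2 ^+ j.+1 = 2 ^+ j + 2 ^+ j :> R); last by rewrite exprS; lra.
apply: (le_trans (approx_error_mul hX _ _ (idx2 j) (idx2 j))).
have : E (2 ^+ j) a * E (2 ^+ j) b <= E (2 ^+ j) a * nrm b.
  by rewrite ler_wpM2l//; exact: (approx_error_le_nrm hX).
rewrite -/E; lra.
Qed.

Lemma approx_space_mul a b : S a -> S b -> S (a * b).
Proof.
move=> /approx_space_dyadic Sa /approx_space_dyadic Sb; apply/approx_space_dyadic.
have ra : 0 <= rho * nrm a by rewrite mulr_ge0 ?nrm_ge0// ltW.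
have rb : 0 <= rho * (2 * nrm b) by rewrite !mulr_ge0 ?nrm_ge0// ltW.
pose v j := rho * nrm a * t_ b j + rho * (2 * nrm b) * t_ a j.
have v0 j : 0 <= v j by rewrite addr_ge0// mulr_ge0.
(* The product is controlled from index 1 on; the recurrence lemma absorbs the shift. *)
apply: (@lp_bounded_recurrence _ _ _ v) => // [j|].
  by apply: (le_trans (t_mul _ _ _)); rewrite lerDr mulr_ge0.
by apply: (lp_bounded_lincomb hp ra rb _ _ _ _ Sb Sa).
Qed.

(** Chosen so that [rho * eps] is 1/4, the contraction factor of [lp_bounded_recurrence]. *)
Let eps := (4 * rho)^-1.

(* Here [u = 1 + d u], so [t_mul] bounds the errors of [u] at scale [2^(j+1)] by
   a quarter of those at scale [2^j], up to the errors of [d]. *)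
Lemma approx_space_inv_near_one d u : S d -> nrm d <= eps -> (1 - d) * u = 1 ->
  S u.
Proof.
move=> /approx_space_dyadic Sd dle du; apply/approx_space_dyadic.
have ue : u = 1 *: 1 + d * u.
  by rewrite scale1r -du mulrBl mul1r addrNK.
have c0 : 0 <= rho * (2 * nrm u) by rewrite !mulr_ge0 ?nrm_ge0// ltW.
apply: (@lp_bounded_recurrence _ _ _ (fun j => rho * (2 * nrm u) * t_ d j))
    => // [j|j|].
- exact: mulr_ge0.
- apply: (@le_trans _ _ (t_ (d * u) j.+1)).
    rewrite /t_ ler_wpM2l//; first by rewrite exprn_ge0// ltW.
    rewrite {1}ue; apply: (le_trans (approx_error_lincomb hX _ _ _ (idx2 j.+1))).
    rewrite (approx_error_mem hX (x := 1)) ?mulr0 ?add0r//.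
    apply: (scheme_mono hX) (scheme1 hX) => //; last by rewrite exprn_ege1 ?ler1n.
    exact: (idx2 0).
  apply: (le_trans (t_mul _ _ _)); rewrite lerD2r ler_wpM2r//.
  by rewrite -ler_pdivlMl// mulrC -invfM.
- apply: (lp_bounded_lincomb hp (lexx 0) c0 _ _ _ _ Sd Sd) => // j.
    exact: mulr_ge0.
  by rewrite mul0r add0r.
Qed.

(** [b^-1 * c] equals [1 - d] with [d = b^-1 * (b - c)] of norm at most [eps], so its inverse
    [c^-1 * b] is in the space. *)
Lemma approx_space_inv_open b c : S b -> b \is a GRing.unit -> S b^-1 ->
  S c -> c \is a GRing.unit -> nrm b^-1 * nrm (b - c) <= eps -> S c^-1.
Proof.
move=> Sb ub Sbi Sc uc small.
have -> : c^-1 = (c^-1 * b) * b^-1 by rewrite mulrK.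
apply: approx_space_mul => //.
apply: (@approx_space_inv_near_one (b^-1 * (b - c))).
- by apply: approx_space_mul => //; exact: approx_space_sub.
- exact: le_trans (nrm_leM _ _) small.
- by rewrite mulrBr mulVr// opprB addrC addrNK mulrA mulrK// mulVr.
Qed.

(** Closeness is now measured with the inverse whose membership is sought. The identity
    [b^-1 = c^-1 - c^-1 * (b - c) * b^-1] gives [nrm b^-1 <= 2 * nrm c^-1], and halving [eps] pays
    for the 2. *)
Lemma approx_space_inv_closed b c : S b -> b \is a GRing.unit -> S b^-1 ->
  S c -> c \is a GRing.unit -> nrm c^-1 * nrm (b - c) <= eps / 2 -> S c^-1.
Proof.
move=> Sb ub Sbi Sc uc small.
have eps1 : eps <= 1 by have h := rho1; rewrite invf_le1; lra.
apply: (approx_space_inv_open Sb ub Sbi Sc uc).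
have : nrm b^-1 <= 2 * nrm c^-1.
  have be : b^-1 = c^-1 - c^-1 * (b - c) * b^-1.
    by rewrite mulrBr mulrBl mulVr// mulrK// mul1r opprB addrC addrNK.
  have : nrm b^-1 <= nrm c^-1 + nrm c^-1 * nrm (b - c) * nrm b^-1.
    rewrite {1}be (le_trans (nrm_leD _ _))// nrmN lerD2l.
    by rewrite (le_trans (nrm_leM _ _))// ler_wpM2r ?nrm_ge0// nrm_leM.
  have := ler_wpM2r (nrm_ge0 b^-1) small.
  have := ler_wpM2r (nrm_ge0 b^-1) eps1.
  lra.
move=> /(ler_wpM2r (nrm_ge0 (b - c))); lra.
Qed.

Lemma approx_space_inv_segment y : S y ->
  (forall s : R, 0 <= s <= 1 -> 1 - (s%:C)%C *: (1 - y) \is a GRing.unit) ->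
  S y^-1.
Proof.
move=> Sy unit_seg; pose f (s : R) : A := 1 - (s%:C)%C *: (1 - y).
have Sf s : S (f s).
  rewrite /f addrC -scaleNr.
  apply: approx_space_lincomb; last exact: approx_space_one.
  by apply: approx_space_sub => //; exact: approx_space_one.
have nf s t : nrm (f s - f t) = `|s - t| * nrm (1 - y).
  rewrite /f opprB addrC addrA addrNK -scalerBl -rmorphB nrmZ.
  by rewrite normc_def/= expr0n addr0 sqrtr_sqr distrC.
suff : S (f 1)^-1 by rewrite /f scale1r opprB addrC addrNK.
apply: (@unit_interval_locally_constant _ (fun s => S (f s)^-1)); last first.
  by rewrite /f scale0r subr0 invr1; exact: approx_space_one.
move=> s s01; pose N := nrm (f s)^-1 * nrm (1 - y) + 1.
have N0 : 0 < N by rewrite ltr_wpDl ?mulr_ge0 ?nrm_ge0.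
have e0 : 0 < eps by rewrite invr_gt0 mulr_gt0.
exists (eps / 2 / N) => [|t t01 st]; first by rewrite !divr_gt0.
have small : nrm (f s)^-1 * nrm (f s - f t) <= eps / 2.
  rewrite nf mulrCA; apply: (@le_trans _ _ (`|s - t| * N)).
    by rewrite ler_wpM2l// lerDl.
  by rewrite -ler_pdivlMr// ltW.
(* The radius involves the inverse of [f s] only: from s to t it feeds the open step, from t to s
   the closed one. *)
split=> Si.
  by apply: (@approx_space_inv_open (f s)) => //;
    [exact: unit_seg|exact: unit_seg|lra].
by apply: (@approx_space_inv_closed (f t)) => //;
  [exact: unit_seg|exact: unit_seg|rewrite nrmB].
Qed.

End ApproximationSpace.

(** * Invertibility from symmetry *)

Section InverseClosed.
Variables (R : realType) (A : banachAlgType R[i]) (star : A -> A).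
Set Implicit Arguments.
Unset Strict Implicit.
Implicit Types a x : A.

Lemma star_unit x : is_involution star -> x \is a GRing.unit ->
  star x \is a GRing.unit.
Proof.
move=> inv ux.
have star1 : star 1 = 1.
  by have := starM inv 1 (star 1); rewrite mul1r (starK inv) mul1r => <-.
apply/GRing.unitrP; exists (star x^-1).
by rewrite -!(starM inv) mulVr// mulrV.
Qed.

(** For 0 < s < 1 the element is s times [star x * x] minus the scalar 1 - 1/s, which is negative
    and so outside the spectrum. The endpoints are 1 and [star x * x]. *)
Lemma symmetric_segment_unit x (s : R) : symmetric_algebra star ->
  x \is a GRing.unit -> 0 <= s <= 1 ->
  1 - (s%:C)%C *: (1 - star x * x) \is a GRing.unit.
Proof.
move=> [inv sym] ux /andP[s0 s1].
move: s0; rewrite le_eqVlt => /predU1P[<-|s0].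
  by rewrite scale0r subr0 unitr1.
move: s1; rewrite le_eqVlt => /predU1P[->|s1].
  by rewrite scale1r opprB addrC addrNK unitrMl// star_unit.
have sC : (s%:C)%C != 0 :> R[i] by rewrite fmorph_eq0 gt_eqF.
have -> : 1 - (s%:C)%C *: (1 - star x * x) =
    (s%:C)%C *: (star x * x - ((1 - s^-1)%:C)%C%:A).
  have -> : ((1 - s^-1)%:C)%C = 1 - (s%:C)%C^-1 :> R[i].
    by rewrite rmorphB rmorph1 fmorphV.
  rewrite !scalerBr opprB scalerA mulrBr mulr1 divff// scalerBl scale1r opprB.
  by rewrite addrCA.
rewrite scaler_unit ?unitfE//; apply/negPn/negP => /(sym x).
by rewrite /= lecR subr_ge0 leNgt invf_gt1// s1.
Qed.

End InverseClosed.

(** * Transfer of inverses from the scheme to the whole space *)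

Theorem proposition4p3 (R : realType) (A : banachAlgType R[i])
  (star : A -> A) (k : index_kind) (X : R -> set A) (p : \bar R) (r : R)
  (hA : symmetric_algebra star)
  (hX : approximation_scheme star k X)
  (hp : (1%:E <= p)%E) (hr : 0 < r) :
  inverse_closed (approx_space k X p r).
Proof.
split.
  split=> [|z a b|a b]; rewrite !in_setE.
  - exact: (approx_space_one hX).
  - exact: (approx_space_lincomb hX).
  - exact: (approx_space_mul hX).
move=> a Sa ua.
have X_inv j x : X (2 ^+ j) x -> x \is a GRing.unit -> approx_space k X p r x^-1.
  move=> Xx ux; have kj : index_set k (2 ^+ j : R) by exact: index_set_exp2.
  have Xsx : X (2 ^+ j) (star x) by rewrite (scheme_star hX kj); exists x.
  have Sx := approx_space_scheme hX hp hr Xx.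
  have Ssx := approx_space_scheme hX hp hr Xsx.
  have usx := star_unit hA.1 ux.
  have -> : x^-1 = (star x * x)^-1 * star x by rewrite invrM// mulrVK.
  apply: (approx_space_mul hX) => //.
  apply: (approx_space_inv_segment hX) => //; first exact: (approx_space_mul hX).
  by move=> s s01; exact: symmetric_segment_unit.
have rho1 : 1 < 2 `^ r.
  have := @gt0_ltr_powR R r hr 1 2.
  rewrite !nnegrE powR1; apply => //; lra.
have rho0 : 0 < 2 `^ r by exact: lt_trans rho1.
(* [eta] is the distance to a that [approx_space_inv_closed] tolerates; the added 1 keeps the
   denominator positive. *)
pose eta := (4 * 2 `^ r)^-1 / 2 / (nrm a^-1 + 1).
have n1 : 0 < nrm a^-1 + 1 by rewrite ltr_wpDl ?nrm_ge0.
have eta0 : 0 < eta by rewrite !divr_gt0// invr_gt0 mulr_gt0.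
have etaE : nrm a^-1 * eta <= (4 * 2 `^ r)^-1 / 2.
  by rewrite /eta mulrA ler_pdivrMr// mulrC ler_wpM2l// ?lerDl.
(* The dyadic sequence of a is bounded, so its error at 2^j is at most M 2^(-jr), which tends to
   0. *)
have [j [x Xx ax]] : exists j, exists2 x, X (2 ^+ j) x & nrm (a - x) < eta.
  have /(approx_space_dyadic hX hp hr) := Sa.
  move=> /(lp_bounded_sup hp)[j|M tM].
    rewrite mulr_ge0 ?exprn_ge0 ?(ltW rho0)//.
    by apply: (approx_error_ge0 hX); exact: index_set_exp2.
  have cvg0 : (fun n => M * (2 `^ r)^-1 ^+ n) @ \oo --> (0 : R).
    by apply: cvg_geometric; rewrite ger0_norm ?invr_ge0 ?invf_lt1// ltW.
  have /cvgrPdist_lt/(_ eta eta0)[N _ hN] := cvg0.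
  have := hN N (leqnn N); rewrite /= sub0r normrN => MN; exists N.
  have kN : index_set k (2 ^+ N : R) by exact: index_set_exp2.
  have : approx_error X (2 ^+ N) a < eta.
    apply: le_lt_trans MN; apply: le_trans (ler_norm _).
    by rewrite exprVn ler_pdivlMr ?exprn_gt0// mulrC.
  apply: contraPP => /forall2NP far; apply/negP; rewrite -leNgt.
  have := @approx_error_glb _ _ _ _ _ hX _ a 1 0 eta kN ler01.
  rewrite mul1r addr0; apply => x Xx; rewrite mul1r addr0 leNgt; apply/negP.
  by case: (far x).
have small : nrm a^-1 * nrm (x - a) <= (4 * 2 `^ r)^-1 / 2.
  apply: le_trans etaE; rewrite nrmB ler_wpM2l ?nrm_ge0//; exact: ltW.
(* x is the product of a and [a^-1 * x], and the latter is within 1/2 of 1. *)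
have ux : x \is a GRing.unit.
  rewrite -[x](mulVKr ua) unitrMr//; apply: unit_near_one.
  rewrite -(mulVr ua) -mulrBr (le_trans (nrm_leM _ _))// nrmB (le_trans small)//.
  by rewrite ler_piMl// invf_le1 ?mulr_gt0//; lra.
(* The closed step fits, because [small] involves the inverse of a rather than that of x. *)
apply: (approx_space_inv_closed hX hp hr _ ux _ Sa ua small).
  exact: (approx_space_scheme hX hp hr Xx).
exact: X_inv Xx ux.
Qed.
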